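(* For every set of formulas $\Gamma\cup\{A\}\subseteq For(\Sigma)$: $\Gamma\models_{\mathcal{M}_{LET_K}} A$ if and only if $\Gamma\vdash_{LET_K} A$.
   Context: Fix a denumerable set of propositional variables and let $For(\Sigma)$ be the set of formulas over $\Sigma=\{\land,\lor,\to,\neg,\circ\}$. The logic $LET_K$ is given by the natural deduction system with the following rules (derivations defined as usual; bracketed hypotheses are discharged); $\Gamma\vdash_{LET_K}A$ means $A$ is derivable from premises in $\Gamma$: ($\land$I) from $A$ and $B$ infer $A\land B$; ($\land$E) from $A\land B$ infer $A$, and infer $B$; ($\lor$I) from $A$ infer $A\lor B$, from $B$ infer $A\lor B$; ($\lor$E) from $A\lor B$, a derivation of $C$ from $[A]$ and a derivation of $C$ from $[B]$, infer $C$; ($\neg\land$I) from $\neg A$ infer $\neg(A\land B)$, from $\neg B$ infer $\neg(A\land B)$; ($\neg\land$E) from $\neg(A\land B)$, a derivation of $C$ from $[\neg A]$ and one of $C$ from $[\neg B]$, infer $C$; ($\neg\lor$I) from $\neg A$ and $\neg B$ infer $\neg(A\lor B)$; ($\neg\lor$E) from $\neg(A\lor B)$ infer $\neg A$, and infer $\neg B$; (DN) from $A$ infer $\neg\neg A$, and from $\neg\neg A$ infer $A$; ($\to$I) from a derivation of $B$ from $[A]$ infer $A\to B$; ($\to$E) from $A\to B$ and $A$ infer $B$; ($\to_{CL}$) axiom $A\lor(A\to B)$; ($\neg\to$I) from $A$ and $\neg B$ infer $\neg(A\to B)$; ($\neg\to$E) from $\neg(A\to B)$ infer $A$, and infer $\neg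 B$; (EXP$^\circ$) from $\circ A$, $A$, $\neg A$ infer $B$; (PEM$^\circ$) from $\circ A$ infer $A\lor\neg A$. Let $\{0,1\}$ be the two-element Boolean algebra with $\sqcap,\sqcup,\sim$ and $a\Rightarrow b=\sim a\sqcup b$. An Nmatrix is a triple $(M,\mathrm{D},\mathcal{O})$ with $\emptyset\ne\mathrm{D}\subseteq M$ and $\mathcal{O}(\#):M^n\to\wp(M)\setminus\{\emptyset\}$ for each $n$-ary connective $\#$; a valuation is a map $v$ with $v(\#(A_1,\dots,A_n))\in\mathcal{O}(\#)(v(A_1),\dots,v(A_n))$; $\Gamma\models A$ iff every valuation mapping all of $\Gamma$ into $\mathrm{D}$ maps $A$ into $\mathrm{D}$. The Nmatrix $\mathcal{M}_{LET_K}$ has domain $B_{LET_K}=\{z\in\{0,1\}^3: z_3\le z_1\sqcup z_2,\ z_1\sqcap z_2\sqcap z_3=0\}=\{T=(1,0,1),T_0=(1,0,0),\mathsf{b}=(1,1,0),\mathsf{n}=(0,0,0),F_0=(0,1,0),F=(0,1,1)\}$, designated set $\mathrm{D}=\{T,T_0,\mathsf{b}\}$, and multioperations ($u$ ranging over $B_{LET_K}$): $z\tilde\land w=\{u:u_1=z_1\sqcap w_1,u_2=z_2\sqcup w_2\}$; $z\tilde\lor w=\{u:u_1=z_1\sqcup w_1,u_2=z_2\sqcap w_2\}$; $z\tilde\to w=\{u:u_1=z_1\Rightarrow w_1,u_2=z_1\sqcap w_2\}$; $\tilde\neg z=\{u:u_1=z_2,u_2=z_1\}$; $\tilde\circ z=\{u:u_1=z_3\}$.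 *)

(* Defs.v *)
From HB Require Import structures.
From mathcomp Require Import all_boot all_order.
From mathcomp Require Import classical_sets.

Set Implicit Arguments.
Unset Strict Implicit.
Unset Printing Implicit Defensive.

Local Open Scope classical_set_scope.

Inductive form : Type :=
  | Var  of nat
  | Conj of form & form
  | Disj of form & form
  | Impl of form & form
  | Neg  of form
  | Circ of form.

(* [LETK Gamma A]: there is a natural deduction derivation of [A] whose
   undischarged hypotheses all belong to [Gamma]; a subderivation that may use
   a hypothesis discharged by the rule lives in the enlarged context. *)
Inductive LETK : set form -> form -> Prop :=
  | Hyp Gamma A : Gamma A -> LETK Gamma A
  | ConjI Gamma A B :
      LETK Gamma A -> LETK Gamma B -> LETK Gamma (Conj A B)
  | ConjE1 Gamma A B : LETK Gamma (Conj A B) -> LETK Gamma A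
  | ConjE2 Gamma A B : LETK Gamma (Conj A B) -> LETK Gamma B
  | DisjI1 Gamma A B : LETK Gamma A -> LETK Gamma (Disj A B)
  | DisjI2 Gamma A B : LETK Gamma B -> LETK Gamma (Disj A B)
  | DisjE Gamma A B C :
      LETK Gamma (Disj A B) ->
      LETK (Gamma `|` [set A]) C -> LETK (Gamma `|` [set B]) C ->
      LETK Gamma C
  | NegConjI1 Gamma A B : LETK Gamma (Neg A) -> LETK Gamma (Neg (Conj A B))
  | NegConjI2 Gamma A B : LETK Gamma (Neg B) -> LETK Gamma (Neg (Conj A B))
  | NegConjE Gamma A B C :
      LETK Gamma (Neg (Conj A B)) ->
      LETK (Gamma `|` [set Neg A]) C -> LETK (Gamma `|` [set Neg B]) C ->
      LETK Gamma C
  | NegDisjI Gamma A B :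
      LETK Gamma (Neg A) -> LETK Gamma (Neg B) -> LETK Gamma (Neg (Disj A B))
  | NegDisjE1 Gamma A B : LETK Gamma (Neg (Disj A B)) -> LETK Gamma (Neg A)
  | NegDisjE2 Gamma A B : LETK Gamma (Neg (Disj A B)) -> LETK Gamma (Neg B)
  | NegNegI Gamma A : LETK Gamma A -> LETK Gamma (Neg (Neg A))
  | NegNegE Gamma A : LETK Gamma (Neg (Neg A)) -> LETK Gamma A
  | ImplI Gamma A B :
      LETK (Gamma `|` [set A]) B -> LETK Gamma (Impl A B)
  | ImplE Gamma A B :
      LETK Gamma (Impl A B) -> LETK Gamma A -> LETK Gamma B
  | ImplCL Gamma A B : LETK Gamma (Disj A (Impl A B))
  | NegImplI Gamma A B :
      LETK Gamma A -> LETK Gamma (Neg B) -> LETK Gamma (Neg (Impl A B))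
  | NegImplE1 Gamma A B : LETK Gamma (Neg (Impl A B)) -> LETK Gamma A
  | NegImplE2 Gamma A B : LETK Gamma (Neg (Impl A B)) -> LETK Gamma (Neg B)
  | ExpCirc Gamma A B :
      LETK Gamma (Circ A) -> LETK Gamma A -> LETK Gamma (Neg A) ->
      LETK Gamma B
  | PemCirc Gamma A :
      LETK Gamma (Circ A) -> LETK Gamma (Disj A (Neg A)).

Record nmatrix : Type := Nmatrix {
  carrier :> Type;
  designated : set carrier;
  conjO : carrier -> carrier -> set carrier;
  disjO : carrier -> carrier -> set carrier;
  implO : carrier -> carrier -> set carrier;
  negO : carrier -> set carrier;
  circO : carrier -> set carrier;
  designated_neq0 : designated !=set0;
  conjO_neq0 : forall z w, conjO z w !=set0;
  disjO_neq0 : forall z w, disjO z w !=set0;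
  implO_neq0 : forall z w, implO z w !=set0;
  negO_neq0 : forall z, negO z !=set0;
  circO_neq0 : forall z, circO z !=set0 }.

Record valuation (M : nmatrix) (v : form -> M) : Prop := Valuation {
  val_conj : forall A B, conjO (v A) (v B) (v (Conj A B));
  val_disj : forall A B, disjO (v A) (v B) (v (Disj A B));
  val_impl : forall A B, implO (v A) (v B) (v (Impl A B));
  val_neg : forall A, negO (v A) (v (Neg A));
  val_circ : forall A, circO (v A) (v (Circ A)) }.

Definition entails (M : nmatrix) (Gamma : set form) (A : form) : Prop :=
  forall v : form -> M, valuation v ->
    (forall B, Gamma B -> designated (v B)) -> designated (v A).

Definition snapshot (z : bool * bool * bool) : bool :=
  let: (z1, z2, z3) := z in
  (z3 <= (z1 || z2))%O && ((z1 && z2 && z3) == false).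

Definition BLETK : Type := {z : bool * bool * bool | snapshot z}.

Definition pr1 (z : BLETK) : bool := (val z).1.1.
Definition pr2 (z : BLETK) : bool := (val z).1.2.
Definition pr3 (z : BLETK) : bool := (val z).2.

Definition vT  : BLETK := exist _ (true, false, true) erefl.
Definition vT0 : BLETK := exist _ (true, false, false) erefl.
Definition vb  : BLETK := exist _ (true, true, false) erefl.
Definition vn  : BLETK := exist _ (false, false, false) erefl.
Definition vF0 : BLETK := exist _ (false, true, false) erefl.
Definition vF  : BLETK := exist _ (false, true, true) erefl.

Lemma BLETK_enum : [set: BLETK] = [set vT; vT0; vb; vn; vF0; vF].
Proof.
apply/seteqP; split=> // z _; case: z => -[[[] []] []] //= p;
  rewrite (bool_irrelevance p erefl).
- by do 3 left; right.
- by do 5 left.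
- by do 4 left; right.
- by right.
- by left; right.
- by do 2 left; right.
Qed.

Definition LETK_designated : set BLETK := [set vT; vT0; vb].

Definition LETK_conj (z w : BLETK) : set BLETK :=
  [set u | pr1 u = pr1 z && pr1 w /\ pr2 u = pr2 z || pr2 w].
Definition LETK_disj (z w : BLETK) : set BLETK :=
  [set u | pr1 u = pr1 z || pr1 w /\ pr2 u = pr2 z && pr2 w].
Definition LETK_impl (z w : BLETK) : set BLETK :=
  [set u | pr1 u = (~~ pr1 z || pr1 w) /\ pr2 u = pr1 z && pr2 w].
Definition LETK_neg (z : BLETK) : set BLETK :=
  [set u | pr1 u = pr2 z /\ pr2 u = pr1 z].
Definition LETK_circ (z : BLETK) : set BLETK :=
  [set u | pr1 u = pr3 z].

Lemma BLETK_ex (a b : bool) : exists u : BLETK, pr1 u = a /\ pr2 u = b.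
Proof. by case: a b => -[]; [exists vb|exists vT0|exists vF0|exists vn]. Qed.

Lemma LETK_designated_neq0 : LETK_designated !=set0.
Proof. by exists vb; right. Qed.
Lemma LETK_conj_neq0 z w : LETK_conj z w !=set0.
Proof. exact: BLETK_ex. Qed.
Lemma LETK_disj_neq0 z w : LETK_disj z w !=set0.
Proof. exact: BLETK_ex. Qed.
Lemma LETK_impl_neq0 z w : LETK_impl z w !=set0.
Proof. exact: BLETK_ex. Qed.
Lemma LETK_neg_neq0 z : LETK_neg z !=set0.
Proof. exact: BLETK_ex. Qed.
Lemma LETK_circ_neq0 z : LETK_circ z !=set0.
Proof. by have [u [u1 _]] := BLETK_ex (pr3 z) false; exists u. Qed.

Definition MLETK : nmatrix :=
  Nmatrix LETK_designated_neq0 LETK_conj_neq0 LETK_disj_neq0 LETK_impl_neq0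
    LETK_neg_neq0 LETK_circ_neq0.

(* Main.v *)
(** Soundness is by induction on derivations. For completeness, by Zorn's lemma
    and compactness a set not deriving [A] extends to a maximal such set; it is
    deductively closed and prime, so sending [B] to the membership bits of [B],
    [Neg B] and [Circ B] is a valuation designating exactly its members. *)

From mathcomp Require Import all_boot all_order boolp.
Require Import Defs.
From mathcomp Require Import classical_sets.

Set Implicit Arguments.
Unset Strict Implicit.
Unset Printing Implicit Defensive.

Local Open Scope classical_set_scope.

(** * Designation as a Boolean condition, and soundness *)

Lemma designatedE (u : MLETK) : designated u <-> pr1 u.
Proof.
split=> [|u1]; first by case=> [[->|->]|->].
have : [set: BLETK] u by [].
by rewrite BLETK_enum => -[[[[[->|u2]|u2]|u2]|u2]|u2];
  [left; left|left; right|right|..]; rewrite // u2 in u1.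
Qed.

(** This bound and the next lemma unpack the two conditions of [snapshot]; they make [PemCirc] and
    [ExpCirc] sound, respectively. *)
Lemma pr3_le (z : BLETK) : pr3 z -> pr1 z || pr2 z.
Proof. by case: z => -[[[] []] []]. Qed.

Lemma pr123_false (z : BLETK) : pr1 z -> pr2 z -> pr3 z -> False.
Proof. by case: z => -[[[] []] []]. Qed.

Lemma LETK_sound (Gamma : set form) (A : form) :
  LETK Gamma A -> entails MLETK Gamma A.
Proof.
move=> H v vv vG; apply/designatedE.
have {}vG B : Gamma B -> pr1 (v B) by move=> /vG /designatedE.
case: vv => vC vD vI vN vO.
(* Nondeterminism touches only the third bit (for [Circ], also the second). The remaining bits obey
   Boolean equations, so each rule reduces to a Boolean check. *)
have C1 B C : pr1 (v (Conj B C)) = pr1 (v B) && pr1 (v C) by case: (vC B C).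
have C2 B C : pr2 (v (Conj B C)) = pr2 (v B) || pr2 (v C) by case: (vC B C).
have D1 B C : pr1 (v (Disj B C)) = pr1 (v B) || pr1 (v C) by case: (vD B C).
have D2 B C : pr2 (v (Disj B C)) = pr2 (v B) && pr2 (v C) by case: (vD B C).
have I1 B C : pr1 (v (Impl B C)) = ~~ pr1 (v B) || pr1 (v C).
  by case: (vI B C).
have I2 B C : pr2 (v (Impl B C)) = pr1 (v B) && pr2 (v C) by case: (vI B C).
have N1 B : pr1 (v (Neg B)) = pr2 (v B) by case: (vN B).
have N2 B : pr2 (v (Neg B)) = pr1 (v B) by case: (vN B).
have O1 B : pr1 (v (Circ B)) = pr3 (v B) := vO B.
have ext G B : (forall C, G C -> pr1 (v C)) -> pr1 (v B) ->
    forall C, (G `|` [set B]) C -> pr1 (v C).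
  by move=> vG' vB C [/vG'|->].
elim: H vG => {Gamma A}.
- by move=> G A GA; apply.
- by move=> G A B _ hA _ hB vG; rewrite C1 hA ?hB.
- by move=> G A B _ h /h; rewrite C1 => /andP[].
- by move=> G A B _ h /h; rewrite C1 => /andP[].
- by move=> G A B _ h /h; rewrite D1 => ->.
- by move=> G A B _ h /h; rewrite D1 => ->; rewrite orbT.
- move=> G A B C _ h _ hA _ hB vG; move: (h vG); rewrite D1.
  by case/orP=> [/(ext _ _ vG)/hA|/(ext _ _ vG)/hB].
- by move=> G A B _ h /h; rewrite !N1 C2 => ->.
- by move=> G A B _ h /h; rewrite !N1 C2 => ->; rewrite orbT.
- move=> G A B C _ h _ hA _ hB vG; move: (h vG); rewrite N1 C2 -!N1.
  by case/orP=> [/(ext _ _ vG)/hA|/(ext _ _ vG)/hB].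
- by move=> G A B _ hA _ hB vG; rewrite N1 D2 -!N1 hA ?hB.
- by move=> G A B _ h /h; rewrite !N1 D2 => /andP[].
- by move=> G A B _ h /h; rewrite !N1 D2 => /andP[].
- by move=> G A _ h /h; rewrite N1 N2.
- by move=> G A _ h /h; rewrite N1 N2.
- move=> G A B _ h vG; rewrite I1.
  by case vA: (pr1 (v A)) => //=; apply/h/ext.
- by move=> G A B _ h _ hA vG; move: (h vG); rewrite I1 hA.
- by move=> G A B vG; rewrite D1 I1 orbA orbN.
- by move=> G A B _ hA _ hB vG; rewrite N1 I2 -N1 hA ?hB.
- by move=> G A B _ h /h; rewrite N1 I2 => /andP[].
- by move=> G A B _ h /h; rewrite !N1 I2 => /andP[].
- move=> G A B _ hO _ hA _ hN vG; exfalso; apply: (@pr123_false (v A)).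
  + exact: hA.
  + by rewrite -N1; exact: hN.
  + by rewrite -O1; exact: hO.
- by move=> G A _ h /h; rewrite O1 D1 N1 => /pr3_le.
Qed.

(** * Weakening, compactness and the Lindenbaum extension *)

Lemma LETK_sub (G H : set form) (A : form) : G `<=` H -> LETK G A -> LETK H A.
Proof.
(* [H] is generalised because the discharging rules use the induction hypothesis with both contexts
   enlarged; apart from [Hyp], only those rules escape [eauto]. *)
move=> + d; elim: d H => {G A}; [|try (econstructor; now eauto)..].
- by move=> G A GA H GH; apply/Hyp/GH.
- by move=> G A B C _ h _ hA _ hB H GH;
    apply: DisjE (h _ GH) (hA _ _) (hB _ _); apply: setSU.
- by move=> G A B C _ h _ hA _ hB H GH;
    apply: NegConjE (h _ GH) (hA _ _) (hB _ _); apply: setSU.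
- by move=> G A B _ h H GH; apply/ImplI/h/setSU.
Qed.

Lemma LETK_cut (G : set form) (A B : form) :
  LETK G A -> LETK (G `|` [set A]) B -> LETK G B.
Proof. by move=> hA /ImplI hAB; apply: ImplE hA. Qed.

(** Every rule has finitely many premises, so directedness yields one member deriving them all.
    Directed families, rather than finite subsets, fit the unions of chains in Zorn's lemma. *)
Lemma LETK_compact (I : Type) (G : I -> set form) (U : set form) (A : form) :
  inhabited I ->
  (forall i j, exists k, G i `<=` G k /\ G j `<=` G k) ->
  U `<=` \bigcup_i G i -> LETK U A -> exists i, LETK (G i) A.
Proof.
case=> i0 + + d.
(* Rules that discharge [B] need the induction hypothesis for the family enlarged by [B]; [extD] and
   [extU] transfer the assumptions to it. *)
have extD (H : I -> set form) B :
    (forall i j, exists k, H i `<=` H k /\ H j `<=` H k) ->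
    forall i j, exists k, H i `|` [set B] `<=` H k `|` [set B] /\
                          H j `|` [set B] `<=` H k `|` [set B].
  by move=> dir i j; have [k [ik jk]] := dir i j; exists k; split; apply: setSU.
have extU (H : I -> set form) V B : V `<=` \bigcup_i H i ->
    V `|` [set B] `<=` \bigcup_i (H i `|` [set B]).
  move=> VH C [/VH [i _ HC]|->]; first by exists i => //; left.
  by exists i0 => //; right.
have two (H : I -> set form) B C D :
    (forall i j, exists k, H i `<=` H k /\ H j `<=` H k) ->
    (exists i, LETK (H i) B) -> (exists i, LETK (H i) C) ->
    (forall i, LETK (H i) B -> LETK (H i) C -> LETK (H i) D) ->
    exists i, LETK (H i) D.
  move=> dir [i hB] [j hC] rule; have [k [ik jk]] := dir i j.
  by exists k; apply: rule; [apply: LETK_sub hB|apply: LETK_sub hC].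
(* Premises that discharge a hypothesis are turned into implications, so that
   all premises live over the same family before being merged by [two]. *)
have disch (H : I -> set form) B C :
    (exists i, LETK (H i `|` [set B]) C) -> exists i, LETK (H i) (Impl B C).
  by case=> i h; exists i; apply: ImplI.
have undisch V B C : LETK V (Impl B C) -> LETK (V `|` [set B]) C.
  move=> h; apply: (ImplE (A := B)); last by apply: Hyp; right.
  by apply: LETK_sub h; left.
elim: d G => {U A}.
- by move=> U A UA G _ /(_ _ UA) [i _ GA]; exists i; apply: Hyp.
- by move=> U A B _ hA _ hB G dir UG;
    apply: two (hA _ dir UG) (hB _ dir UG) _ => // i; apply: ConjI.
- by move=> U A B _ h G dir UG; have [i hi] := h _ dir UG; exists i;
    apply: ConjE1 hi.
- by move=> U A B _ h G dir UG; have [i hi] := h _ dir UG; exists i;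
    apply: ConjE2 hi.
- by move=> U A B _ h G dir UG; have [i hi] := h _ dir UG; exists i;
    apply: DisjI1.
- by move=> U A B _ h G dir UG; have [i hi] := h _ dir UG; exists i;
    apply: DisjI2.
- move=> U A B C _ h _ hA _ hB G dir UG.
  have /disch {}hA := hA _ (extD _ A dir) (extU _ _ A UG).
  have /disch {}hB := hB _ (extD _ B dir) (extU _ _ B UG).
  (* [two] merges two premises at a time, so the two implications are first packed into one
     conjunction. *)
  apply: (two _ _ _ _ dir (h _ dir UG)
    (two _ _ _ (Conj (Impl A C) (Impl B C)) dir hA hB _)) => i.
    exact: ConjI.
  move=> hi hAB; apply: DisjE hi _ _; apply: undisch.
    exact: ConjE1 hAB.
  exact: ConjE2 hAB.
- by move=> U A B _ h G dir UG; have [i hi] := h _ dir UG; exists i;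
    apply: NegConjI1.
- by move=> U A B _ h G dir UG; have [i hi] := h _ dir UG; exists i;
    apply: NegConjI2.
- move=> U A B C _ h _ hA _ hB G dir UG.
  have /disch {}hA := hA _ (extD _ (Neg A) dir) (extU _ _ (Neg A) UG).
  have /disch {}hB := hB _ (extD _ (Neg B) dir) (extU _ _ (Neg B) UG).
  apply: (two _ _ _ _ dir (h _ dir UG)
    (two _ _ _ (Conj (Impl (Neg A) C) (Impl (Neg B) C)) dir hA hB _)) => i.
    exact: ConjI.
  move=> hi hAB; apply: NegConjE hi _ _; apply: undisch.
    exact: ConjE1 hAB.
  exact: ConjE2 hAB.
- by move=> U A B _ hA _ hB G dir UG;
    apply: two (hA _ dir UG) (hB _ dir UG) _ => // i; apply: NegDisjI.
- by move=> U A B _ h G dir UG; have [i hi] := h _ dir UG; exists i;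
    apply: NegDisjE1 hi.
- by move=> U A B _ h G dir UG; have [i hi] := h _ dir UG; exists i;
    apply: NegDisjE2 hi.
- by move=> U A _ h G dir UG; have [i hi] := h _ dir UG; exists i;
    apply: NegNegI.
- by move=> U A _ h G dir UG; have [i hi] := h _ dir UG; exists i;
    apply: NegNegE.
- by move=> U A B _ h G dir UG;
    apply/disch/(h _ (extD _ A dir) (extU _ _ A UG)).
- by move=> U A B _ hAB _ hA G dir UG;
    apply: two (hAB _ dir UG) (hA _ dir UG) _ => // i; apply: ImplE.
- by move=> U A B G _ _; exists i0; apply: ImplCL.
- by move=> U A B _ hA _ hB G dir UG;
    apply: two (hA _ dir UG) (hB _ dir UG) _ => // i; apply: NegImplI.
- by move=> U A B _ h G dir UG; have [i hi] := h _ dir UG; exists i;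
    apply: NegImplE1 hi.
- by move=> U A B _ h G dir UG; have [i hi] := h _ dir UG; exists i;
    apply: NegImplE2 hi.
- move=> U A B _ hO _ hA _ hN G dir UG.
  apply: (two _ _ _ _ dir (hO _ dir UG)
    (two _ _ _ (Conj A (Neg A)) dir (hA _ dir UG) (hN _ dir UG) _)) => i.
    exact: ConjI.
  by move=> hi hAN; apply: ExpCirc hi (ConjE1 hAN) (ConjE2 hAN).
- by move=> U A _ h G dir UG; have [i hi] := h _ dir UG; exists i;
    apply: PemCirc.
Qed.

(** Zorn is applied to the sets whose union with [Gamma] does not derive [A], rather than to
    supersets of [Gamma], so that the empty union of the empty chain also qualifies. *)
Lemma Lindenbaum (Gamma : set form) (A : form) : ~ LETK Gamma A ->
  exists D : set form, [/\ Gamma `<=` D, ~ LETK D A &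
    forall B, ~ D B -> LETK (D `|` [set B]) A].
Proof.
move=> GA.
have [F FP chain|D [DA Dmax]] :=
  @Zorn_bigcup _ [set D : set form | ~ LETK (Gamma `|` D) A].
  (* Compactness indexes by a whole type: sets outside the chain contribute just [Gamma], which
     keeps the family inhabited and directed even for an empty chain. *)
  pose G (X : set form) := Gamma `|` [set B | F X /\ X B].
  move=> /(@LETK_compact _ G) [||B [GB|[X FX XB]]|X].
  - by constructor; exact: set0.
  - move=> X Y; have [FX|nFX] := pselect (F X); last first.
      by exists Y; split=> // B [GB|[]//]; left.
    have [FY|nFY] := pselect (F Y); last first.
      by exists X; split=> // B [GB|[]//]; left.
    by have [XY|YX] := chain X Y FX FY; [exists Y|exists X]; split=> //;
      apply: setUS => B [_ ?]; split=> //; auto.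
  - by exists set0 => //; left.
  - by exists X => //; right.
  - have [FX d|nFX d] := pselect (F X).
      by apply: (FP X FX); apply: LETK_sub d; apply: setUS => B [].
    by apply: GA; apply: LETK_sub d => B [|[]].
exists (Gamma `|` D); split=> // B nB; apply: contrapT => nd.
apply: (Dmax (D `|` [set B])); last by rewrite /= setUA.
split; first exact: subsetUl.
by move=> /(_ B) sB; apply: nB; right; apply: sB; right.
Qed.

(** * Maximal sets not deriving [A] and their canonical valuation *)

Section MaximalNonDeriving.
Variables (D : set form) (A : form).
Hypotheses (DA : ~ LETK D A)
  (Dmax : forall B, ~ D B -> LETK (D `|` [set B]) A).

(** If [B] were missing, adding it would derive [A], and a cut would derive [A] from [D] alone. *)
Lemma maximal_closed B : LETK D B -> D B.
Proof. by move=> d; apply: contrapT => /Dmax /(LETK_cut d). Qed.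

(** If both disjuncts were missing, each would yield [A] when added to [D], hence so would [D] by
    [DisjE]. The next lemma argues likewise with [NegConjE]. *)
Lemma maximal_disj B C : D (Disj B C) -> D B \/ D C.
Proof.
move=> h; apply: contrapT => /not_orP [/Dmax dB /Dmax dC].
by apply: DA; apply: DisjE dB dC; apply: Hyp.
Qed.

Lemma maximal_negconj B C : D (Neg (Conj B C)) -> D (Neg B) \/ D (Neg C).
Proof.
move=> h; apply: contrapT => /not_orP [/Dmax dB /Dmax dC].
by apply: DA; apply: NegConjE dB dC; apply: Hyp.
Qed.

(** The triple (1,1,1) would derive [A] by [ExpCirc]; (0,0,1) contradicts [PemCirc] together with
    primeness. *)
Lemma maximal_snapshot B :
  snapshot (`[< D B >], `[< D (Neg B) >], `[< D (Circ B) >]).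
Proof.
rewrite /snapshot; case: asboolP => dB; case: asboolP => dN;
  case: asboolP => dO //=.
- by case: DA; apply: (@ExpCirc _ B); apply: Hyp.
- by case: (@maximal_disj B (Neg B)) => //; apply/maximal_closed/PemCirc/Hyp.
Qed.

Definition canonical_val (B : form) : MLETK :=
  exist (fun z => is_true (snapshot z)) _ (maximal_snapshot B).

Lemma canonical_valuation : valuation canonical_val.
Proof.
have clo1 B C : (LETK D B -> LETK D C) -> D B -> D C.
  by move=> BC /(@Hyp D) /BC /maximal_closed.
(* The [Circ] clause holds by computation: the third bit of [B] and the first bit of [Circ B] both
   record membership of [Circ B]. *)
split=> [B C|B C|B C|B|B] //; rewrite /=.
- split; rewrite /pr1 /pr2 /= -?asbool_and -?asbool_or; apply: asbool_equiv_eq.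
  + split=> [h|[/(@Hyp D) hB /(@Hyp D) hC]]; last exact/maximal_closed/ConjI.
    by split; apply: clo1 h; [apply: ConjE1|apply: ConjE2].
  + split=> [/maximal_negconj //|[]]; apply: clo1.
      exact: NegConjI1.
    exact: NegConjI2.
- split; rewrite /pr1 /pr2 /= -?asbool_and -?asbool_or; apply: asbool_equiv_eq.
  + split=> [/maximal_disj //|[]]; apply: clo1.
      exact: DisjI1.
    exact: DisjI2.
  + split=> [h|[/(@Hyp D) hB /(@Hyp D) hC]]; last exact/maximal_closed/NegDisjI.
    by split; apply: clo1 h; [apply: NegDisjE1|apply: NegDisjE2].
- split; rewrite /pr1 /pr2 /= -?asbool_neg -?asbool_and -?asbool_or;
    apply: asbool_equiv_eq.
  + split=> [h|[nB|/(@Hyp D) hC]].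
    * have [dB|nB] := pselect (D B); last by left.
      by right; apply: maximal_closed; apply: (ImplE (A := B)); apply: Hyp.
    (* Since [B] is not in [D], primeness applied to the axiom [ImplCL] leaves the implication. *)
    * by case: (maximal_disj (maximal_closed (ImplCL D B C))).
    * by apply/maximal_closed/ImplI; apply: LETK_sub hC; left.
  + split=> [h|[/(@Hyp D) hB /(@Hyp D) hC]]; last exact/maximal_closed/NegImplI.
    by split; apply: clo1 h; [apply: NegImplE1|apply: NegImplE2].
(* The first equation is definitional; the second is double negation. *)
- split=> //; rewrite /pr1 /pr2 /=; apply: asbool_equiv_eq.
  by split; apply: clo1; [apply: NegNegE|apply: NegNegI].
Qed.

Lemma canonical_designated B : designated (canonical_val B) <-> D B.
Proof.
by split=> [/designatedE/asboolP|DB] //; apply/designatedE/asboolP.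
Qed.

End MaximalNonDeriving.

Lemma LETK_complete (Gamma : set form) (A : form) :
  entails MLETK Gamma A -> LETK Gamma A.
Proof.
move=> h; apply: contrapT => /Lindenbaum [D [GD DA Dmax]].
have dE := canonical_designated DA Dmax.
apply: (DA); apply: Hyp; apply/dE/h; first exact: canonical_valuation.
by move=> B /GD /dE.
Qed.

Theorem theorem2p17 (Gamma : set form) (A : form) :
  entails MLETK Gamma A <-> LETK Gamma A.
Proof. by split; [apply: LETK_complete|apply: LETK_sound]. Qed.
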